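(* Let $\delta>0$ and let $\gamma\ge 0$ be rational. Then there exists $n_0\in\mathbb{N}$ such that for every $n\ge n_0$ with $\gamma n\in\mathbb{N}_0$ and every $(\gamma n,n)$-stopping rule with stopping time $\tau$ there exists a distribution $F$ on $\mathbb{R}_+$ such that, when the samples and $X_1,\dots,X_n$ are i.i.d.\ from $F$, \[ \mathbb{E}[X_\tau]\le(b(\gamma)+\delta)\cdot\mathbb{E}[\max\{X_1,\dots,X_n\}], \] where $b(\gamma)=\frac{1+\gamma}{e}$ if $\frac1e\ge\frac{\gamma}{1+\gamma}$, and $b(\gamma)=-\gamma\log\frac{\gamma}{1+\gamma}$ otherwise ($\log$ the natural logarithm).
   Context: Let $k\in\mathbb{N}_0$, $n\in\mathbb{N}$. Values $X_1,\dots,X_n$ and samples $S_1,\dots,S_k$ are i.i.d.\ according to a distribution $F$ on $\mathbb{R}_+$. A $(k,n)$-stopping rule is a family $r_1,\dots,r_n$, $r_i:\mathbb{R}_+^{k+i}\to[0,1]$, where $r_i(s_1,\dots,s_k,x_1,\dots,x_i)$ is the probability of stopping at $X_i$ given samples $s$, values $x_1,\dots,x_i$, and not having stopped earlier; the rule does not depend on $F$. Its stopping time $\tau$ satisfies $\Pr[\tau=i\mid S=s,X=x]=\prod_{j<i}(1-r_j(s,x_1,\dots,x_j))\,r_i(s,x_1,\dots,x_i)$, with $X_\infty:=0$. *)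

(* Defs.v *)
From HB Require Import structures.
From mathcomp Require Import all_boot all_order all_algebra.
From mathcomp Require Import all_classical all_reals all_analysis.
Set Implicit Arguments.
Unset Strict Implicit.
Unset Printing Implicit Defensive.
Import Order.TTheory GRing.Theory Num.Theory.
Import numFieldNormedType.Exports.

Local Open Scope classical_set_scope.
Local Open Scope ring_scope.

Definition nonneg_tuple (R : realType) (m : nat) : set (m.-tuple R) :=
  [set y | forall l : 'I_m, 0 <= tnth y l].

(* Indices are 0-based: the rule for i : 'I_n sees the k samples followed by
   the first i.+1 values. Rules are total functions on tuples of reals, but
   only their restriction to the nonnegative orthant is constrained, and only
   that restriction matters below. Borel measurability is what makes the
   expectation of the stopped value meaningful for every distribution. *)
Record stopping_rule (R : realType) (k n : nat) := StoppingRule {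
  stop_prob :> forall i : 'I_n, (k + i.+1).-tuple R -> R ;
  stop_prob_itv : forall (i : 'I_n) (y : (k + i.+1).-tuple R),
    nonneg_tuple y -> 0 <= @stop_prob i y <= 1 ;
  stop_prob_measurable : forall i : 'I_n,
    measurable_fun (@nonneg_tuple R (k + i.+1)) (@stop_prob i) }.

Definition prefix_tuple (T : Type) (n : nat) (x : n.-tuple T) (i : 'I_n) :
    i.+1.-tuple T :=
  [tuple tnth x (widen_ord (ltn_ord i) l) | l < i.+1].

Definition stop_at (R : realType) (k n : nat) (r : stopping_rule R k n)
    (s : k.-tuple R) (x : n.-tuple R) (i : 'I_n) : R :=
  (\prod_(j < n | (j < i)%N) (1 - r j [tuple of s ++ prefix_tuple x j])) *
  r i [tuple of s ++ prefix_tuple x i].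

Section Random.
Context {d : measure_display} {Omega : measurableType d} {R : realType}.
Variable P : probability Omega R.

Definition mutually_independent (I : finType) (Y : I -> {RV P >-> R}) : Prop :=
  forall (J : {set I}) (B : I -> set R),
    (forall i, i \in J -> measurable (B i)) ->
    P [set w | forall i, i \in J -> B i (Y i w)] =
    (\prod_(i in J) P [set w | B i (Y i w)])%E.

Definition iid (F : probability R R) (I : finType) (Y : I -> {RV P >-> R})
    : Prop :=
  mutually_independent Y /\
  forall (i : I) (A : set R), measurable A -> distribution P (Y i) A = F A.

Definition joint (k n : nat) (S : 'I_k -> {RV P >-> R})
    (X : 'I_n -> {RV P >-> R}) (t : 'I_k + 'I_n) : {RV P >-> R} :=
  match t with inl j => S j | inr i => X i end.

Definition sample_tuple (m : nat) (Y : 'I_m -> {RV P >-> R}) (w : Omega) :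
    m.-tuple R := [tuple Y i w | i < m].

(* tau w = Some i means stopping at the value of index i, and None means never
   stopping (tau = infinity). The last clause says that stop_at is a version of
   the conditional probability of {tau = i} given the samples and values. *)
Definition is_stopping_time (k n : nat) (r : stopping_rule R k n)
    (S : 'I_k -> {RV P >-> R}) (X : 'I_n -> {RV P >-> R})
    (tau : Omega -> option 'I_n) : Prop :=
  forall i : 'I_n,
    measurable [set w | tau w = Some i] /\
    forall A : set (k.-tuple R * n.-tuple R), measurable A ->
      let SXA := [set w | A (sample_tuple S w, sample_tuple X w)] in
      P ([set w | tau w = Some i] `&` SXA) =
      (\int[P]_(w in SXA)
         (stop_at r (sample_tuple S w) (sample_tuple X w) i)%:E)%E.

Definition stopped_value (n : nat) (X : 'I_n -> {RV P >-> R})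
    (tau : Omega -> option 'I_n) (w : Omega) : R :=
  if tau w is Some i then X i w else 0.

(* The default 0 is harmless: this is used for nonnegative X and 0 < n only. *)
Definition max_value (n : nat) (X : 'I_n -> {RV P >-> R}) (w : Omega) : R :=
  \big[Num.max/0]_(i < n) X i w.

End Random.

Definition bound (R : realType) (g : R) : R :=
  if g / (1 + g) <= (expR 1)^-1 then (1 + g) / expR 1
  else - g * ln (g / (1 + g)).

(* Main.v *)
Require Import Defs.
From mathcomp Require Import all_boot all_order all_algebra.
From mathcomp Require Import ring lra.
From mathcomp Require Import all_classical all_reals all_analysis.
From mathcomp Require Import measurable_realfun.
Import Order.TTheory GRing.Theory Num.Theory.
Local Open Scope classical_set_scope.
Local Open Scope ring_scope.
Set Implicit Arguments.
Unset Strict Implicit.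
Unset Printing Implicit Defensive.

(* A Bayesian argument gives F. Fix a huge base B and, for every s <= L, let F_s
   put a tiny mass p on the level B^s and spread the rest uniformly over the
   lower levels B^0, ..., B^(s-1). Under F_s, both expectations are governed, up
   to a relative error vanishing with p and 1/B, by the event that exactly one
   value has level s; so E[X_tau] is essentially p B^s times the sum over i of
   the probability h_s(i) of stopping at i when X_i has level s and all earlier
   values and samples are uniform below s.

   Give s the prior weight 1/s. This prior is scale invariant, hence whatever
   the levels seen so far, the a-th of them is a record with probability about
   1/a, and seeing actual values is of no help. For the mixture x_a of the
   h_s(i), a = k + i being counted from 1, this yields the constraints
   x_a + sum_(k < c < a) x_c / c <= 1 of the linear program of the secretary
   problem with k samples among N = k + n items, with an error that vanishes
   relative to the total weight ln L of the prior. The dual solution 1 + ln(a/N)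
   for a > max(k, N/e) bounds the sum of the x_a by n b(gamma) + 1. The bound on
   average over s then holds for some s. *)

(** * Averages over words *)

Section Average.
Variable R : realFieldType.
Implicit Types (f g : seq nat -> R) (s m : nat).

(* The mean of f over the words of length m on the alphabet {0, ..., s - 1}. *)
Fixpoint avg s m f : R :=
  if m is m'.+1 then s%:R^-1 * \sum_(t < s) avg s m' (fun y => f (rcons y t))
  else f [::].

Lemma le_avg s m f g :
  (forall y, size y = m -> f y <= g y) -> avg s m f <= avg s m g.
Proof.
elim: m f g => [|m IH] f g fg /=; first exact: fg.
apply: ler_wpM2l; first by rewrite invr_ge0.
by apply: ler_sum => t _; apply: IH => y sy; apply: fg; rewrite size_rcons sy.
Qed.

Lemma eq_avg s m f g :
  (forall y, size y = m -> f y = g y) -> avg s m f = avg s m g.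
Proof. by move=> fg; apply/le_anti; rewrite !le_avg// => y /fg ->. Qed.

Lemma avgD s m f g : avg s m (fun y => f y + g y) = avg s m f + avg s m g.
Proof.
elim: m f g => [//|m IH] f g /=; rewrite -mulrDr -big_split/=; congr (_ * _).
by apply: eq_bigr => t _; rewrite IH.
Qed.

Lemma avgZ s m (c : R) f : avg s m (fun y => c * f y) = c * avg s m f.
Proof.
elim: m f => [//|m IH] f /=; rewrite mulrCA; congr (_ * _).
by rewrite mulr_sumr; apply: eq_bigr => t _; rewrite IH.
Qed.

Lemma avg_sum s m (I : finType) (P : pred I) (F : I -> seq nat -> R) :
  avg s m (fun y => \sum_(i | P i) F i y) = \sum_(i | P i) avg s m (F i).
Proof.
elim: m F => [//|m IH] F /=.
under eq_bigr do rewrite IH.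
by rewrite exchange_big /= mulr_sumr.
Qed.

Lemma avg_const s m (c : R) : (0 < s)%N -> avg s m (fun=> c) = c.
Proof.
move=> s0; elim: m => [//|m IH] /=.
by rewrite IH sumr_const card_ord -[c *+ _]mulr_natl mulKf// pnatr_eq0 -lt0n.
Qed.

Lemma avg_prefix s m m' f : (0 < s)%N -> (m <= m')%N ->
  (forall y t, (m <= size y)%N -> f (rcons y t) = f y) ->
  avg s m' f = avg s m f.
Proof.
move=> s0 + fP; elim: m' => [|m' IH]; first by rewrite leqn0 => /eqP ->.
rewrite leq_eqVlt => /predU1P[->//|]; rewrite ltnS => mm'; rewrite -(IH mm') /=.
rewrite (eq_bigr (fun=> avg s m' f)); last first.
  by move=> t _; apply: eq_avg => y sy; rewrite fP// sy.
rewrite sumr_const card_ord -[avg _ _ _ *+ _]mulr_natl mulKf//.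
by rewrite pnatr_eq0 -lt0n.
Qed.

(** By conditioning: a uniform letter below [s] is below [t] with probability [t / s], and is then
    uniform below [t]. *)
Lemma avg_below s t m f : (0 < t <= s)%N ->
  avg s m (fun y => (all (ltn^~ t) y)%:R * f y) = (t%:R / s%:R) ^+ m * avg t m f.
Proof.
move=> /andP[t0 ts]; elim: m f => [|m IH] f /=; first by rewrite expr0.
rewrite (eq_bigr (fun u : 'I_s => if (u < t)%N then
    (t%:R / s%:R) ^+ m * avg t m (fun y => f (rcons y u)) else 0)); last first.
  move=> u _; under eq_avg => y _ do rewrite all_rcons -mulnb natrM -mulrA.
  by rewrite avgZ IH; case: ltnP; rewrite ?mul1r ?mul0r.
rewrite -big_mkcond/= -(big_ord_widen _
  (fun u => (t%:R / s%:R) ^+ m * avg t m (fun y => f (rcons y u))) ts).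
rewrite -mulr_sumr exprSr; have tn0 : t%:R != 0 :> R by rewrite pnatr_eq0 -lt0n.
by rewrite -!mulrA (mulrCA s%:R^-1 t%:R^-1) mulVKf// mulrCA.
Qed.

(** As [f] is nonnegative, it suffices to keep the words whose last letter [t] is a strict record;
    given [t], [avg_below] makes the earlier letters uniform below [t]. *)
Lemma avg_record s m f : (forall y, 0 <= f y) ->
  s%:R^-1 * \sum_(1 <= t < s)
    (t%:R / s%:R) ^+ m * avg t m (fun y => f (rcons y t)) <= avg s m.+1 f.
Proof.
move=> f0 /=; apply: ler_wpM2l; first by rewrite invr_ge0.
rewrite -(big_mkord xpredT (fun t => avg s m (fun y => f (rcons y t)))).
case: s => [|s]; first by rewrite !big_geq.
(* The last letter 0 contributes a nonnegative term, which is dropped; hence [t] starts at 1. *)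
rewrite [leRHS]big_nat_recl//= -[leLHS]add0r lerD//.
  by rewrite -[leLHS](@avg_const s.+1 m)//; exact: le_avg.
rewrite big_add1/= big_nat [leRHS]big_nat; apply: ler_sum => t /andP[_ ts].
rewrite -avg_below; last by rewrite andTb; apply: ltnW.
by apply: le_avg => y _; case: all; rewrite ?mul1r// mul0r.
Qed.

End Average.

(** * Bernoulli inequalities and discrete integrals of powers *)

Section PowerSums.
Variable R : realFieldType.

Lemma exchange_sum_triangle (m M : nat) (F : nat -> nat -> R) :
  \sum_(m <= s < M) \sum_(m <= t < s) F s t =
  \sum_(m <= t < M) \sum_(t.+1 <= s < M) F s t.
Proof.
transitivity (\sum_(m <= s < M) \sum_(m <= t < M | (t < s)%N) F s t).
  rewrite big_nat [RHS]big_nat; apply: eq_bigr => s /andP[_ sM].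
  by rewrite (big_nat_widen _ _ _ _ _ (ltnW sM)).
rewrite (exchange_big_dep_nat xpredT)//= big_nat [RHS]big_nat.
by apply: eq_bigr => t /andP[mt _]; rewrite (big_nat_widenl t.+1 m)// leqW.
Qed.

Lemma oneBVS (s : nat) : 1 - s.+1%:R^-1 = s%:R / s.+1%:R :> R.
Proof. by field; rewrite ?(nat1r, natr1) pnatr_eq0. Qed.

Lemma exprn_bernoulli (a : nat) (x : R) : 0 <= x <= 1 -> 1 - a%:R * x <= (1 - x) ^+ a.
Proof.
move=> /andP[x0 x1]; elim: a => [|a IH]; first by rewrite mul0r subr0 expr0.
rewrite exprS; apply: le_trans (ler_wpM2l _ IH); last lra.
have := mulr_ge0 (ler0n R a) (mulr_ge0 x0 x0); rewrite -natr1; nra.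
Qed.

(** First-order expansion with a crude quadratic error; it will bound the probability that no value
    has the top level. *)
Lemma exprn_1subr_le (q : R) (m : nat) : 0 <= q <= 1 ->
  (1 - q) ^+ m <= 1 - m%:R * q + m%:R ^+ 2 * q ^+ 2.
Proof.
move=> /andP[q0 q1]; elim: m => [|m IH]; first by rewrite expr0; lra.
rewrite exprS; apply: le_trans (ler_wpM2l _ IH) _; first lra.
rewrite -natr1; have := ler0n R m; set x := m%:R => x0.
have : 0 <= x ^+ 2 * (q ^+ 2 * q) by rewrite !mulr_ge0// exprn_ge0.
have : 0 <= x * q ^+ 2 by rewrite mulr_ge0// exprn_ge0.
have : 0 <= q ^+ 2 by rewrite exprn_ge0.
nra.
Qed.

(** A discrete integral: by Bernoulli, [1 / s ^ a - 1 / (s + 1) ^ a] is at most [a / s ^ (a + 1)],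
    and these differences telescope. *)
Lemma sum_exprVn_ge (a t L : nat) : (0 < a)%N -> (t <= L)%N ->
  a%:R^-1 * ((t.+1%:R ^+ a)^-1 - (L.+1%:R ^+ a)^-1)
    <= \sum_(t.+1 <= s < L.+1) (s%:R ^+ a.+1)^-1 :> R.
Proof.
move=> a0 tL; rewrite (_ : _ - _ = \sum_(t.+1 <= s < L.+1)
    ((s%:R ^+ a)^-1 - (s.+1%:R ^+ a)^-1)); last first.
  rewrite (telescope_sumr_eq (fun s => - (s%:R ^+ a)^-1)) ?opprK//.
    by rewrite addrC.
  by move=> i _; rewrite opprK addrC.
rewrite mulr_sumr big_nat [leRHS]big_nat; apply: ler_sum => s /andP[ts _].
have s0 : 0 < s%:R :> R by rewrite ltr0n; apply: leq_trans ts.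
have S0 : 0 < s.+1%:R :> R by rewrite ltr0n.
rewrite ler_pdivrMl ?ltr0n//.
have -> : (s.+1%:R ^+ a)^-1 = (s%:R ^+ a)^-1 * (1 - s.+1%:R^-1) ^+ a :> R.
  by rewrite oneBVS expr_div_n mulKf// expf_neq0// lt0r_neq0.
rewrite -[X in X - _]mulr1 -mulrBr exprSr invfM mulrCA.
apply: ler_wpM2l; first by rewrite invr_ge0 exprn_ge0// ltW.
have s01 : 0 <= (s.+1%:R^-1 : R) <= 1.
  by rewrite invr_ge0 ltW//= invf_le1// ler1n.
have := exprn_bernoulli a s01.
have : a%:R * s.+1%:R^-1 <= a%:R * s%:R^-1 :> R.
  by rewrite ler_wpM2l// lef_pV2// ler_nat.
by move=> h1 h2; rewrite lerBlDl -lerBlDr (le_trans _ h2)// lerD2l lerN2.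
Qed.

(** The main term is [t ^ a] times the integral of [1 / s ^ (a + 2)] from [t] on. The first error
    comes from starting at [t + 1], the second from truncating at [L]; summed over [1 <= t <= L],
    each is at most 1. *)
Lemma record_weight_ge (a t L : nat) : (0 < t <= L)%N ->
  (t%:R * a.+1%:R)^-1 - (t%:R * t.+1%:R)^-1 - (a.+1%:R * L.+1%:R)^-1
    <= t%:R ^+ a * \sum_(t.+1 <= s < L.+1) (s%:R ^+ a.+2)^-1 :> R.
Proof.
move=> /andP[t0 tL].
have ta0 : 0 <= t%:R ^+ a :> R by rewrite exprn_ge0.
apply: le_trans (ler_wpM2l ta0 (@sum_exprVn_ge a.+1 t L isT tL)).
have T0 : 0 < t%:R :> R by rewrite ltr0n.
have A0 : 0 < a.+1%:R :> R by rewrite ltr0n.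
have S0 : 0 < t.+1%:R :> R by rewrite ltr0n.
have L0 : 0 < L.+1%:R :> R by rewrite ltr0n.
have -> : t%:R ^+ a * (a.+1%:R^-1 * ((t.+1%:R ^+ a.+1)^-1 - (L.+1%:R ^+ a.+1)^-1)) =
   (t%:R * a.+1%:R)^-1 * (t%:R / t.+1%:R) ^+ a.+1
   - a.+1%:R^-1 / L.+1%:R * (t%:R / L.+1%:R) ^+ a :> R.
  rewrite !expr_div_n !exprS; field.
  by rewrite !expf_neq0 ?lt0r_neq0//= ?(nat1r,natr1) ?lt0r_neq0.
have h1 : 1 - a.+1%:R / t.+1%:R <= (t%:R / t.+1%:R) ^+ a.+1 :> R.
  by rewrite -oneBVS; apply: exprn_bernoulli; rewrite invr_ge0 ltW//= invf_le1// ler1n.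
have h2 : (t%:R / L.+1%:R) ^+ a <= 1 :> R.
  apply: exprn_ile1; first by rewrite divr_ge0// ltW.
  by rewrite ler_pdivrMr// mul1r ler_nat leqW.
apply: lerB.
  have -> : (t%:R * a.+1%:R)^-1 - (t%:R * t.+1%:R)^-1 =
    (t%:R * a.+1%:R)^-1 * (1 - a.+1%:R / t.+1%:R) :> R.
    by field; rewrite ?(nat1r,natr1) !lt0r_neq0.
  by apply: ler_wpM2l => //; rewrite invr_ge0 mulr_ge0// ltW.
by rewrite invfM ler_piMr// mulr_ge0// invr_ge0 ltW.
Qed.

Lemma sum_invMS_le1 (L : nat) : \sum_(1 <= t < L.+1) (t%:R * t.+1%:R)^-1 <= 1 :> R.
Proof.
rewrite (telescope_sumr_eq (fun t => - t%:R^-1))//.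
  by rewrite invr1 opprK addrC gerBl invr_ge0.
move=> [//|t] _; rewrite opprK.
by field; rewrite ?(nat1r,natr1) -?natrD !pnatr_eq0.
Qed.

End PowerSums.

(** * Hitting the top level under the scale-invariant prior *)

Section Game.
Variables (R : realFieldType) (k : nat) (rho : nat -> seq nat -> R).
Hypothesis rho01 : forall i y, 0 <= rho i y <= 1.
(** The decision at index [i] reads the samples and the values up to index [i], that is, the first
    [k + i + 1] letters. *)
Hypothesis rho_rcons : forall i y t, (k + i < size y)%N ->
  rho i (rcons y t) = rho i y.

Definition stop i y := \prod_(j < i) (1 - rho j y) * rho i y.

(* The probability of stopping at the value of index i when it has level s and
   the k + i earlier ones are uniform below s. *)
Definition hit s i := avg s (k + i) (fun y => stop i (rcons y s)).

(** The prior is not normalised: its total mass on the levels 1, ..., [L] is [harmonic_sum L]. *)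
Definition mixed_hit L i := \sum_(1 <= s < L.+1) s%:R^-1 * hit s i.

Definition harmonic_sum L := \sum_(1 <= s < L.+1) s%:R^-1 :> R.

Lemma prod_go01 i y : 0 <= \prod_(j < i) (1 - rho j y) <= 1.
Proof.
apply/andP; split.
  by apply: prodr_ge0 => j _; have := rho01 j y; lra.
by apply: prodr_ile1 => j _; have := rho01 j y; lra.
Qed.

Lemma stop01 i y : 0 <= stop i y <= 1.
Proof.
have /andP[a0 a1] := prod_go01 i y; have /andP[b0 b1] := rho01 i y.
by rewrite mulr_ge0//= mulr_ile1.
Qed.

Lemma sum_stop i y : \sum_(j < i) stop j y = 1 - \prod_(j < i) (1 - rho j y).
Proof.
elim: i => [|i IH]; first by rewrite !big_ord0 subrr.
rewrite !big_ord_recr/= IH /stop; ring.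
Qed.

Lemma stop_rcons i y t : (k + i < size y)%N -> stop i (rcons y t) = stop i y.
Proof.
move=> iy; rewrite /stop rho_rcons//; congr (_ * _); apply: eq_bigr => j _.
by rewrite rho_rcons//; apply: leq_ltn_trans iy; rewrite leq_add2l ltnW.
Qed.

Lemma hit01 s i : (0 < s)%N -> 0 <= hit s i <= 1.
Proof.
move=> s0; apply/andP; split.
  rewrite -[leLHS](@avg_const _ s (k + i))//; apply: le_avg => y _.
  by case/andP: (stop01 i (rcons y s)).
rewrite -[leRHS](@avg_const _ s (k + i))//; apply: le_avg => y _.
by case/andP: (stop01 i (rcons y s)).
Qed.

(** Stopping at [i] requires not having stopped before. The earlier decisions do not see the letter
    [s] in place [k + i], so their probabilities may be computed on uniform words. *)
Lemma hit_le s i : (0 < s)%N ->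
  hit s i <= 1 - \sum_(j < i) avg s (k + j).+1 (stop j).
Proof.
move=> s0.
have -> : 1 - \sum_(j < i) avg s (k + j).+1 (stop j) =
    avg s (k + i) (fun y => 1 + (-1) * \sum_(j < i) stop j y).
  rewrite avgD avgZ avg_const// avg_sum mulN1r; congr (_ - _).
  apply: eq_bigr => j _; apply/esym/avg_prefix => //.
    by rewrite -addnS leq_add2l.
  by move=> y t; exact: stop_rcons.
apply: le_avg => y sy; rewrite sum_stop /stop.
have -> : 1 + -1 * (1 - \prod_(j < i) (1 - rho j y)) =
    \prod_(j < i) (1 - rho j (rcons y s)).
  rewrite mulN1r opprB addrC subrK; apply: eq_bigr => j _.
  by rewrite rho_rcons// sy ltn_add2l.
have /andP[p0 _] := prod_go01 i (rcons y s).
have /andP[r0 r1] := rho01 i (rcons y s).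
by rewrite ler_piMr.
Qed.

(* Against the prior 1/s, "the new value is a record of level t" carries total
   weight about 1/(t (k + j + 1)): records occur at rate 1/(k + j + 1),
   whatever the values seen before. *)
Lemma mixed_stop_ge L j :
  (k + j).+1%:R^-1 * mixed_hit L j - 2
    <= \sum_(1 <= s < L.+1) s%:R^-1 * avg s (k + j).+1 (stop j).
Proof.
set a := (k + j)%N.
(* Only stops at a strict record are kept. Given its level [t], the earlier letters are uniform
   below [t], which produces [hit t j]. *)
apply: (@le_trans _ _ (\sum_(1 <= s < L.+1) s%:R^-1 * (s%:R^-1 *
   \sum_(1 <= t < s) (t%:R / s%:R) ^+ a * hit t j))); last first.
  apply: ler_sum => s _; apply: ler_wpM2l; first by rewrite invr_ge0.
  by apply: avg_record => y; case/andP: (stop01 j y).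
have -> : \sum_(1 <= s < L.+1) s%:R^-1 * (s%:R^-1 *
   \sum_(1 <= t < s) (t%:R / s%:R) ^+ a * hit t j) =
   \sum_(1 <= t < L.+1) hit t j *
     (t%:R ^+ a * \sum_(t.+1 <= s < L.+1) (s%:R ^+ a.+2)^-1).
  rewrite (eq_bigr (fun s => \sum_(1 <= t < s)
      hit t j * (t%:R ^+ a * (s%:R ^+ a.+2)^-1))); last first.
    move=> s _; rewrite !mulr_sumr; apply: eq_bigr => t _.
    by rewrite expr_div_n !exprS !invfM; ring.
  under [RHS]eq_bigr do rewrite !mulr_sumr.
  exact: exchange_sum_triangle.
(* [e t] is the error of [record_weight_ge] at level [t]; the total error stays bounded as [L]
   grows. *)
pose e t : R := (t%:R * t.+1%:R)^-1 + (a.+1%:R * L.+1%:R)^-1.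
have e2 : \sum_(1 <= t < L.+1) e t <= 2.
  rewrite big_split/= -[2]/(1 + 1) lerD ?sum_invMS_le1//.
  rewrite sumr_const_nat subn1 -[_ *+ L.+1.-1]mulr_natl invfM mulrCA.
  rewrite mulr_ile1 ?invr_ge0 ?mulr_ge0 ?invr_ge0//.
    by rewrite invf_le1// ler1n.
  by rewrite ler_pdivrMr ?ltr0n// mul1r ler_nat.
apply: (@le_trans _ _ (\sum_(1 <= t < L.+1)
    (a.+1%:R^-1 * (t%:R^-1 * hit t j) - e t))).
  by rewrite sumrB /mixed_hit mulr_sumr lerB.
rewrite big_nat [leRHS]big_nat; apply: ler_sum => t /andP[t0 tL].
have /andP[h0 h1] := hit01 j t0.
apply: le_trans (ler_wpM2l h0 (@record_weight_ge R a t L _)); last first.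
  by rewrite t0.
have : hit t j * e t <= e t.
  by rewrite ler_piMl// addr_ge0// invr_ge0.
rewrite -addrA -opprD -/(e t) mulrBr invfM => he.
by apply: lerB he; rewrite mulrC [t%:R^-1 * _]mulrC -mulrA.
Qed.

(** The primal constraint: [hit_le] is averaged over the prior and each earlier stopping probability
    is bounded below by [mixed_stop_ge], at a cost of 2 per index. *)
Lemma mixed_hit_constraint L i :
  mixed_hit L i + \sum_(j < i) (k + j).+1%:R^-1 * mixed_hit L j
    <= harmonic_sum L + 2 * i%:R.
Proof.
have h1 : mixed_hit L i <= harmonic_sum L - \sum_(j < i) \sum_(1 <= s < L.+1)
     s%:R^-1 * avg s (k + j).+1 (stop j).
  rewrite exchange_big/= /mixed_hit /harmonic_sum -sumrB.
  rewrite big_nat [leRHS]big_nat; apply: ler_sum => s /andP[s0 _].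
  rewrite -mulr_sumr -[X in X - _]mulr1 -mulrBr.
  by apply: ler_wpM2l (hit_le i s0); rewrite invr_ge0.
have h2 : \sum_(j < i) ((k + j).+1%:R^-1 * mixed_hit L j - 2) <=
   \sum_(j < i) \sum_(1 <= s < L.+1) s%:R^-1 * avg s (k + j).+1 (stop j).
  by apply: ler_sum => j _; exact: mixed_stop_ge.
rewrite sumrB sumr_const card_ord -[2 *+ i]mulr_natr in h2.
lra.
Qed.

Lemma mixed_hit_ge0 L i : 0 <= mixed_hit L i.
Proof.
rewrite /mixed_hit big_nat; apply: sumr_ge0 => s /andP[s0 _].
by rewrite mulr_ge0 ?invr_ge0//; case/andP: (hit01 i s0).
Qed.

End Game.

(** * The linear program of the secretary problem with samples *)

Section LinearProgram.
Variable R : realType.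

(** Weight the dual constraints by [x], exchange the triangular double sum, then apply the primal
    constraints weighted by [lam]. *)
Lemma weak_duality (m M : nat) (x lam : nat -> R) (C : R) :
  (forall b, 0 <= x b) -> (forall b, (m <= b < M)%N -> 0 <= lam b) ->
  (forall b, (m <= b < M)%N -> x b + \sum_(m <= c < b) c%:R^-1 * x c <= C) ->
  (forall b, (m <= b < M)%N ->
    1 <= lam b + b%:R^-1 * \sum_(b.+1 <= c < M) lam c) ->
  \sum_(m <= b < M) x b <= C * \sum_(m <= b < M) lam b.
Proof.
move=> x0 lam0 primal dual.
apply: (@le_trans _ _
    (\sum_(m <= b < M) x b * (lam b + b%:R^-1 * \sum_(b.+1 <= c < M) lam c))).
  rewrite big_nat [leRHS]big_nat; apply: ler_sum => b /dual h.
  by rewrite -[leLHS]mulr1 ler_wpM2l.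
have -> : \sum_(m <= b < M) x b * (lam b + b%:R^-1 * \sum_(b.+1 <= c < M) lam c) =
    \sum_(m <= b < M) lam b * (x b + \sum_(m <= c < b) c%:R^-1 * x c).
  under eq_bigr do rewrite mulrDr !mulr_sumr.
  under [RHS]eq_bigr do rewrite mulrDr !mulr_sumr.
  rewrite !big_split/= exchange_sum_triangle; congr (_ + _).
    by apply: eq_bigr => b _; rewrite mulrC.
  by apply: eq_bigr => b _; apply: eq_bigr => c _; ring.
rewrite mulr_sumr big_nat [leRHS]big_nat; apply: ler_sum => b bM.
by rewrite mulrC ler_wpM2r ?lam0// primal.
Qed.

Lemma ln_le_subr1 (y : R) : 0 < y -> ln y <= y - 1.
Proof. move=> y0; have -> : ln y = ln (1 + (y - 1)) by congr ln; ring.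
by apply: le_ln1Dx; lra. Qed.

Variable N : nat.

(* Up to O(1), the tail sum over b > x of the dual weights 1 + ln (b / N). *)
Definition entropy (x : nat) : R := x%:R * ln (N%:R / x%:R).

Lemma entropyE (x : nat) : (0 < N)%N -> (0 < x)%N -> entropy x = - (x%:R * ln (x%:R / N%:R)).
Proof.
by move=> N0 x0; rewrite /entropy !ln_div ?posrE ?ltr0n//; ring.
Qed.

(** The derivative of [entropy] is [- (1 + ln (x / N))], which is monotone, so the decrease over a
    unit step lies between its values at the endpoints. *)
Lemma entropy_step (x : nat) : (0 < N)%N -> (0 < x)%N ->
  1 + ln (x%:R / N%:R) <= entropy x - entropy x.+1 <= 1 + ln (x.+1%:R / N%:R).
Proof.
move=> N0 x0; rewrite !entropyE//.
have X0 : 0 < x%:R :> R by rewrite ltr0n.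
have X1 : 0 < x.+1%:R :> R by rewrite ltr0n.
have n0 : 0 < N%:R :> R by rewrite ltr0n.
rewrite !ln_div ?posrE//.
have h1 : x%:R * (ln x.+1%:R - ln x%:R) <= 1 :> R.
  rewrite -ln_div ?posrE// -ler_pdivlMl// mulr1.
  apply: le_trans (ln_le_subr1 _) _; first exact: divr_gt0.
  by rewrite -natr1 mulrDl divff ?lt0r_neq0// mul1r addrAC subrr add0r.
have h2 : 1 <= x.+1%:R * (ln x.+1%:R - ln x%:R) :> R.
  rewrite -ler_pdivrMl// mulr1 -[leRHS]opprB -ln_div ?posrE// lerNr.
  apply: le_trans (ln_le_subr1 _) _; first exact: divr_gt0.
  by rewrite -oneBVS addrAC subrr add0r.
set u := ln x.+1%:R in h1 h2 *; rewrite -natr1 in h2 *.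
apply/andP; split; lra.
Qed.

(** The maximum is at [x = N / e]; the proof uses the tangent bound [ln z <= z - 1] at
    [z = N / (x e)]. *)
Lemma entropy_le (x : nat) : (0 < N)%N -> (0 < x)%N -> entropy x <= N%:R / expR 1.
Proof.
move=> N0 x0.
have X0 : 0 < x%:R :> R by rewrite ltr0n.
have n0 : 0 < N%:R :> R by rewrite ltr0n.
have e0 : 0 < expR 1 :> R by exact: expR_gt0.
have nx0 : 0 < N%:R / x%:R :> R by exact: divr_gt0.
have h : ln (N%:R / x%:R) <= N%:R / x%:R / expR 1 :> R.
  have := ln_le_subr1 (divr_gt0 nx0 e0).
  by rewrite ln_div ?posrE// expRK lerD2r.
rewrite /entropy; apply: le_trans (ler_wpM2l (ltW X0) h) _.
by rewrite -mulrA mulrCA mulVKf// ?lt0r_neq0.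
Qed.

(** Telescopes the upper half of [entropy_step], with [entropy N = 0]. *)
Lemma entropy_le_sum (a : nat) : (0 < a)%N -> (a <= N)%N ->
  entropy a <= \sum_(a.+1 <= b < N.+1) (1 + ln (b%:R / N%:R)).
Proof.
move=> a0 aN; have N0 : (0 < N)%N by apply: leq_trans aN.
have n0 : N%:R != 0 :> R by rewrite pnatr_eq0 -lt0n.
have -> : entropy a = \sum_(a <= b < N) (entropy b - entropy b.+1).
  rewrite (telescope_sumr_eq (fun b => - entropy b))//; last first.
    by move=> b _; rewrite opprK addrC.
  by rewrite {2}/entropy divff// ln1 mulr0 oppr0 add0r opprK.
rewrite big_add1/= big_nat [leRHS]big_nat; apply: ler_sum => b /andP[ab _].
by case/andP: (entropy_step N0 (leq_trans a0 ab)).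
Qed.

(** Telescopes the lower half of [entropy_step]; the additive 1 is the term [b = N]. *)
Lemma sum_le_entropy (a : nat) : (0 < a)%N -> (a <= N)%N ->
  \sum_(a <= b < N.+1) (1 + ln (b%:R / N%:R)) <= 1 + entropy a.
Proof.
move=> a0 aN; have N0 : (0 < N)%N by apply: leq_trans aN.
have n0 : N%:R != 0 :> R by rewrite pnatr_eq0 -lt0n.
rewrite big_nat_recr//= divff// ln1 addr0 addrC lerD2l.
have -> : entropy a = \sum_(a <= b < N) (entropy b - entropy b.+1).
  rewrite (telescope_sumr_eq (fun b => - entropy b))//; last first.
    by move=> b _; rewrite opprK addrC.
  by rewrite {2}/entropy divff// ln1 mulr0 oppr0 add0r opprK.
rewrite big_nat [leRHS]big_nat; apply: ler_sum => b /andP[ab _].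
by case/andP: (entropy_step N0 (leq_trans a0 ab)).
Qed.

Lemma dual_weight_ge0 (T b : nat) : N%:R / expR 1 <= T%:R :> R -> (T <= b)%N -> (0 < N)%N ->
  0 <= 1 + ln (b%:R / N%:R) :> R.
Proof.
move=> hT Tb N0; have n0 : 0 < N%:R :> R by rewrite ltr0n.
have e0 : 0 < expR 1 :> R by exact: expR_gt0.
have h : (expR 1)^-1 <= b%:R / N%:R :> R.
  rewrite ler_pdivlMr// mulrC; apply: le_trans hT _; by rewrite ler_nat.
have : ln (expR 1)^-1 <= ln (b%:R / N%:R) :> R.
  by rewrite ler_ln ?posrE ?invr_gt0// (lt_le_trans _ h)// invr_gt0.
by rewrite lnV ?posrE// expRK; lra.
Qed.

(** The dual solution is 0 up to [T] and [1 + ln (b / N)] beyond. The lower bound on [T + 1] makes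
    it nonnegative; the upper bound on [T] gives the dual constraints for [k < b <= T]. *)
Lemma threshold_bound (k T : nat) (x : nat -> R) (C : R) : 0 <= C ->
  (k <= T < N)%N -> N%:R / expR 1 <= T.+1%:R :> R ->
  ((k < T)%N -> T%:R <= N%:R / expR 1 :> R) ->
  (forall b, 0 <= x b) ->
  (forall b, (k < b <= N)%N -> x b + \sum_(k.+1 <= c < b) c%:R^-1 * x c <= C) ->
  \sum_(k.+1 <= b < N.+1) x b <= C * (1 + entropy T.+1).
Proof.
move=> C0 /andP[kT TN] hT kT' x0 hx.
have N0 : (0 < N)%N by apply: leq_ltn_trans TN.
have n0 : 0 < N%:R :> R by rewrite ltr0n.
pose lam b : R := if (b <= T)%N then 0 else 1 + ln (b%:R / N%:R).
have lam_tail : \sum_(T.+1 <= b < N.+1) lam b =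
    \sum_(T.+1 <= b < N.+1) (1 + ln (b%:R / N%:R)).
  by apply: eq_big_nat => b /andP[Tb _]; rewrite /lam leqNgt Tb.
have lam_head a : (a <= T)%N ->
    \sum_(a.+1 <= b < N.+1) lam b = \sum_(T.+1 <= b < N.+1) lam b.
  move=> aT; rewrite (@big_cat_nat _ _ _ T.+1)//=; last exact: ltnW.
  rewrite big_nat big1 ?add0r// => b /andP[_]; rewrite ltnS /lam => ->//.
apply: (@le_trans _ _ (C * \sum_(k.+1 <= b < N.+1) lam b)); last first.
  by apply: ler_wpM2l => //; rewrite lam_head// lam_tail sum_le_entropy.
apply: weak_duality => // b /andP[kb bN].
- rewrite /lam; case: leqP => // Tb; exact: dual_weight_ge0 hT _ _.
- have b0 : 0 < b%:R :> R by rewrite ltr0n; apply: leq_trans kb.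
  have {}b0' : (0 < b)%N by apply: leq_trans kb.
  (* Beyond the threshold the tail sum is at least [entropy b], and [entropy b / b] cancels
     [ln (b / N)]. *)
  rewrite {1}/lam; case: leqP => bT; last first.
    have -> : \sum_(b.+1 <= c < N.+1) lam c =
        \sum_(b.+1 <= c < N.+1) (1 + ln (c%:R / N%:R)).
      apply: eq_big_nat => c /andP[bc _].
      by rewrite /lam leqNgt (ltn_trans bT bc).
    have : entropy b <= \sum_(b.+1 <= c < N.+1) (1 + ln (c%:R / N%:R)).
      exact: entropy_le_sum.
    by rewrite entropyE// -mulrN -ler_pdivlMl// => h; lra.
  (* Up to the threshold the weight vanishes, but the tail sum is at least [entropy T], which is at
     least [T], hence [b], because [N / T] is at least [e]. *)
  rewrite add0r lam_head// lam_tail mulrC ler_pdivlMr// mul1r.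
  have T0 : (0 < T)%N by apply: leq_trans bT.
  apply: le_trans (entropy_le_sum T0 (ltnW TN)).
  apply: (@le_trans _ _ T%:R); first by rewrite ler_nat.
  rewrite /entropy ler_peMr//.
  have t0 : 0 < T%:R :> R by rewrite ltr0n.
  rewrite -[leLHS](@expRK R) ler_ln ?posrE ?expR_gt0 ?divr_gt0//.
  rewrite ler_pdivlMr// mulrC -ler_pdivlMr ?expR_gt0//.
  by apply: kT'; apply: leq_trans kb bT.
Qed.

End LinearProgram.

(** The threshold is [T = k] if [k] exceeds [N / e], and the integer part of [N / e] otherwise. *)
Lemma lp_bound (R : realType) (k N : nat) (x : nat -> R) (C : R) : 0 <= C ->
  (k < N)%N -> (forall b, 0 <= x b) ->
  (forall b, (k < b <= N)%N -> x b + \sum_(k.+1 <= c < b) c%:R^-1 * x c <= C) ->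
  \sum_(k.+1 <= b < N.+1) x b <= C * (1 + if k%:R / N%:R <= (expR 1)^-1 :> R
    then N%:R / expR 1 else k%:R * ln (N%:R / k%:R)).
Proof.
move=> C0 kN x0 hx.
have N0 : (0 < N)%N by apply: leq_ltn_trans kN.
have n0 : 0 < N%:R :> R by rewrite ltr0n.
have e0 : 0 < expR 1 :> R by exact: expR_gt0.
case: ifPn => [kle|]; last first.
  rewrite -ltNge => klt.
  have k0 : (0 < k)%N.
    by rewrite lt0n; apply: contraTneq klt => ->; rewrite mul0r -leNgt invr_ge0 ltW.
  have hk : N%:R / expR 1 <= k%:R :> R.
    by rewrite mulrC -ler_pdivlMr// ltW.
  apply: le_trans (@threshold_bound R N k k x C C0 _ _ _ x0 hx) _.
  - by rewrite leqnn.
  - by rewrite (le_trans hk)// ler_nat.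
  - by rewrite ltnn.
  (* [entropy] does not increase from [k] to [k + 1], as [k] is already past its maximum. *)
  rewrite ler_wpM2l// lerD2l -/(entropy R N k).
  have /andP[h _] := entropy_step R N0 k0.
  have := dual_weight_ge0 hk (leqnn k) N0; lra.
have ne0 : 0 <= N%:R / expR 1 :> R by rewrite divr_ge0// ltW.
have /andP[T1 T2] := truncn_itv ne0.
set T := Num.truncn _ in T1 T2.
apply: le_trans (@threshold_bound R N k T x C C0 _ (ltW T2) (fun=> T1) x0 hx) _.
  apply/andP; split.
    rewrite -ltnS -(@ltr_nat R); apply: le_lt_trans T2.
    by rewrite mulrC -ler_pdivrMr.
  rewrite -(@ltr_nat R); apply: le_lt_trans T1 _.
  by rewrite ltr_pdivrMr// ltr_pMr// -expR0 ltr_expR.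
by rewrite ler_wpM2l// lerD2l entropy_le.
Qed.

(** * Reduction of the expectations to words *)

Lemma exists_discrete_probability (R : realType) (m : nat)
    (w : nat -> {nonneg R}) (a : nat -> R) :
  \sum_(t < m) (w t)%:num = 1 ->
  exists F : probability R R, forall A : set R, F A =
    (\sum_(t < m) (w t)%:num * \1_A (a t))%:E.
Proof.
move=> w1.
pose mu : {measure set R -> \bar R} := msum (fun t => mscale (w t) (@dirac _ R (a t) R)) m.
have muE A : mu A = (\sum_(t < m) (w t)%:num * \1_A (a t))%:E.
  by rewrite /mu/= /msum -sumEFin; apply: eq_bigr => t _; rewrite /mscale/= /dirac EFinM.
have mu1 : mu setT = 1%E.
  by rewrite muE; under eq_bigr do rewrite indicT mulr1; rewrite w1.
(* Normalising only supplies the structure of a probability: [mu] already has mass 1. *)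
exists (mnormalize mu (dirac (0 : R))) => A.
by rewrite /= /mnormalize mu1 onee_eq0/= invr1 mule1; exact: muE.
Qed.

Section Coordinates.
Context {d : measure_display} {Omega : measurableType d} {R : realType}.
Variables (P : probability Omega R) (k n : nat).
Variables (S : 'I_k -> {RV P >-> R}) (X : 'I_n -> {RV P >-> R}).

(** Samples and values form one sequence indexed by [nat], to be compared with words without casts
    between tuple lengths. *)
Definition coord (w : Omega) (l : nat) : R :=
  nth 0 (sample_tuple S w ++ sample_tuple X w) l.

Lemma coordE w (l : 'I_(k + n)) : coord w l = joint S X (fintype.split l) w.
Proof.
rewrite /coord nth_cat size_tuple; case: splitP => j ->.
  by rewrite -tnth_nth tnth_mktuple.
by rewrite addKn -tnth_nth tnth_mktuple.
Qed.

Lemma coord_rshift w (i : 'I_n) : coord w (k + i) = X i w.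
Proof. by rewrite (coordE w (rshift k i)) (unsplitK (inr i)). Qed.

Lemma measurable_coord (l : nat) : measurable_fun setT (coord^~ l).
Proof.
have [lkn|knl] := ltnP l (k + n); last first.
  rewrite (_ : coord^~ l = cst 0); first exact: measurable_cst.
  by apply/funext => w; rewrite /coord nth_default// size_cat !size_tuple.
rewrite (_ : coord^~ l = joint S X (fintype.split (Ordinal lkn)))//.
by apply/funext => w; rewrite -coordE.
Qed.

Lemma measurable_coord_preimage (l : nat) (A : set R) : measurable A ->
  measurable [set w | A (coord w l)].
Proof.
by move=> mA; have := measurable_coord l measurableT mA; rewrite setTI.
Qed.

Variable F : probability R R.
Hypothesis iidF : iid F (joint S X).

Lemma coord_independent (p : pred nat) (A : nat -> set R) :
  (forall l, measurable (A l)) ->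
  P [set w | forall l : 'I_(k + n), p l -> A l (coord w l)] =
  (\prod_(l < k + n | p l) F (A l))%E.
Proof.
move=> mA; have [indep id] := iidF.
pose B (t : 'I_k + 'I_n) := A (unsplit t).
pose J := [set t : 'I_k + 'I_n | p (unsplit t)]%SET.
have -> : [set w | forall l : 'I_(k + n), p l -> A l (coord w l)] =
    [set w | forall t, t \in J -> B t (joint S X t w)].
  apply/seteqP; split => w /= h.
    by move=> t; rewrite inE => /h; rewrite coordE unsplitK.
  move=> l pl; rewrite coordE; have := h (fintype.split l).
  by rewrite inE /B splitK; apply.
rewrite indep; last by move=> t _; exact: mA.
rewrite (reindex (@fintype.split k n)); last first.
  by exists (@unsplit k n) => t _; [exact: splitK|exact: unsplitK].
apply: eq_big => l; first by rewrite inE splitK.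
by move=> _; rewrite -[RHS]/(F (A l)) -[in RHS](splitK l) -(id (fintype.split l)).
Qed.

End Coordinates.

Lemma nth_prefix_tuple (T : Type) (n : nat) (x0 : T) (x : n.-tuple T) (i : 'I_n)
    (l : nat) : (l < i.+1)%N -> nth x0 (prefix_tuple x i) l = nth x0 x l.
Proof.
move=> li; have := tnth_nth x0 (prefix_tuple x i) (Ordinal li).
by rewrite tnth_mktuple (tnth_nth x0).
Qed.

Section RuleOnWords.
Variables (R : realType) (k n : nat) (r : stopping_rule R k n) (v : nat -> R).

(* The rule r seen through the levels: y codes the values v y_0, v y_1, ... *)
Definition word_rule (i : nat) (y : seq nat) : R :=
  if insub i is Some i' then r i' [tuple v (nth 0%N y l) | l < k + (i' : 'I_n).+1]
  else 0.

Hypothesis v0 : forall t, 0 <= v t.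

Lemma word_rule01 i y : 0 <= word_rule i y <= 1.
Proof.
rewrite /word_rule; case: insubP => [i' _ _|_]; last by rewrite lexx ler01.
by apply: stop_prob_itv => l; rewrite tnth_mktuple.
Qed.

Lemma word_rule_rcons i y t : (k + i < size y)%N ->
  word_rule i (rcons y t) = word_rule i y.
Proof.
move=> iy; rewrite /word_rule; case: insubP => // i' _ ii'; congr (r _ _).
apply: eq_from_tnth => l; rewrite !tnth_mktuple nth_rcons.
by rewrite (leq_trans (ltn_ord l))// addnS ii'.
Qed.

Lemma word_ruleE (s : k.-tuple R) (x : n.-tuple R) (i : 'I_n) y :
  (forall l, (l <= k + i)%N -> nth 0 (s ++ x) l = v (nth 0%N y l)) ->
  r i [tuple of s ++ prefix_tuple x i] = word_rule i y.
Proof.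
move=> sxy; rewrite /word_rule valK; congr (r _ _).
apply: eq_from_tnth => l; rewrite tnth_mktuple -sxy; last first.
  by rewrite -ltnS -addnS.
rewrite (tnth_nth 0)/= !nth_cat size_tuple; case: ltnP => // kl.
by rewrite nth_prefix_tuple// ltn_subLR.
Qed.

Lemma stop_at_word (s : k.-tuple R) (x : n.-tuple R) (i : 'I_n) y :
  (forall l, (l <= k + i)%N -> nth 0 (s ++ x) l = v (nth 0%N y l)) ->
  stop_at r s x i = stop word_rule i y.
Proof.
move=> sxy; rewrite /stop_at /stop (word_ruleE sxy); congr (_ * _).
rewrite [RHS](big_ord_widen _ (fun j => 1 - word_rule j y) (ltnW (ltn_ord i))).
apply: eq_bigr => j ji; rewrite (@word_ruleE _ _ _ y)// => l lj.
by apply: sxy; rewrite (leq_trans lj)// leq_add2l ltnW.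
Qed.

End RuleOnWords.

(** * From probabilities of single words to averages over words *)

Section AverageOverWords.
Context {d : measure_display} {Omega : measurableType d} {R : realType}.
Variables (P : probability Omega R) (Z : Omega -> nat -> R) (v : nat -> R).
Hypothesis mZ : forall l a, measurable [set w | Z w l = a].

Definition word_event (y : seq nat) : set Omega :=
  [set w | forall l, (l < size y)%N -> Z w l = v (nth 0%N y l)].

Definition low_event (s m : nat) : set Omega :=
  [set w | forall l, (l < m)%N -> exists2 t, (t < s)%N & Z w l = v t].

Lemma measurable_word_event y : measurable (word_event y).
Proof.
have -> : word_event y = \bigcap_(l in `I_(size y)) [set w | Z w l = v (nth 0%N y l)].
  by [].
by apply: fin_bigcap_measurable => // l _; exact: mZ.
Qed.

Lemma measurable_low_event s m : measurable (low_event s m).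
Proof.
have -> : low_event s m = \bigcap_(l in `I_m) \bigcup_(t in `I_s) [set w | Z w l = v t].
  by [].
apply: fin_bigcap_measurable => // l _.
by apply: fin_bigcup_measurable => // t _; exact: mZ.
Qed.

(** A union bound over the levels of the first [m] coordinates, taken one coordinate at a time from
    the last; the factor [s ^ - m] turns the sum over words into [avg]. *)
Lemma low_event_le_avg (s m : nat) (E : set Omega) (c : R) (G : seq nat -> R) :
  measurable E ->
  (forall y, size y = m -> all (ltn^~ s) y ->
    (P (E `&` word_event y) <= (c * s%:R^-1 ^+ m * G y)%:E)%E) ->
  (P (E `&` low_event s m) <= (c * avg s m G)%:E)%E.
Proof.
elim: m E c G => [|m IH] E c G mE hG.
  have := hG [::] erefl isT; rewrite expr0 mulr1; apply: le_trans.
  by rewrite le_measure ?inE//; [exact: measurableI (measurable_low_event _ _)|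
    exact: measurableI (measurable_word_event _)|move=> w []].
(* The level of the last coordinate is absorbed into the event, so that the induction hypothesis
   handles the others. *)
pose E' t := E `&` [set w | Z w m = v t].
have mE' t : measurable (E' t) by apply: measurableI => //; exact: mZ.
have mU t : measurable (E' t `&` low_event s m).
  by apply: measurableI => //; exact: measurable_low_event.
apply: (@le_trans _ _ (P (\big[setU/set0]_(t < s) (E' t `&` low_event s m)))).
  rewrite le_measure ?inE//; first 2 last.
  - move=> w [Ew lw]; have [t ts wt] := lw m (ltnSn m).
    rewrite -(bigcup_mkord s (fun t => E' t `&` low_event s m)); exists t => //=; split => // l lm.
    by apply: lw; rewrite ltnW.
  - by apply: measurableI => //; exact: measurable_low_event.
  - by apply: bigsetU_measurable.
apply: le_trans (Boole_inequality P (fun t _ => mU t)) _.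
rewrite /= mulrA mulr_sumr -sumEFin.
apply: lee_sum => t _; apply: IH => // y sy ys.
rewrite -(mulrA c) -exprS.
apply: le_trans (hG (rcons y t) _ _); last 2 first.
- by rewrite size_rcons sy.
- by rewrite all_rcons /= ltn_ord.
rewrite le_measure ?inE//.
- by apply: measurableI => //; exact: measurable_word_event.
- by apply: measurableI => //; exact: measurable_word_event.
move=> w [[Ew wt] wy]; split => // l; rewrite size_rcons ltnS nth_rcons.
rewrite leq_eqVlt => /predU1P[->|ly]; last by rewrite ly; exact: wy.
by rewrite ltnn eqxx sy.
Qed.

End AverageOverWords.

Lemma measurable_nth_cat (R : realType) (k n l : nat) :
  measurable_fun setT (fun ab : k.-tuple R * n.-tuple R => nth 0 (ab.1 ++ ab.2) l).
Proof.
have [lk|kl] := ltnP l k.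
  rewrite (_ : (fun _ => _) = (fun x : k.-tuple R => tnth x (Ordinal lk)) \o fst).
    by apply: measurableT_comp; [exact: measurable_tnth|exact: measurable_fst].
  by apply/funext => ab /=; rewrite nth_cat size_tuple lk (tnth_nth 0).
have [lkn|knl] := ltnP (l - k) n.
  rewrite (_ : (fun _ => _) = (fun x : n.-tuple R => tnth x (Ordinal lkn)) \o snd).
    by apply: measurableT_comp; [exact: measurable_tnth|exact: measurable_snd].
  by apply/funext => ab /=; rewrite nth_cat size_tuple ltnNge kl (tnth_nth 0).
rewrite (_ : (fun _ => _) = cst 0); first exact: measurable_cst.
apply/funext => ab; rewrite nth_default// size_cat !size_tuple.
by rewrite -leq_subRL.
Qed.

(** * Expectations when [F] has a top level [s] of mass [p] and lower levels smaller by a factor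
    [B] *)

Section Expectations.
Context {d : measure_display} {Omega : measurableType d} {R : realType}.
Variables (P : probability Omega R) (k n : nat).
Variables (S : 'I_k -> {RV P >-> R}) (X : 'I_n -> {RV P >-> R}).
Variables (r : stopping_rule R k n) (tau : Omega -> option 'I_n).
Variables (F : probability R R) (v : nat -> R) (s : nat) (p B : R).
Hypotheses (X0 : forall i w, 0 <= X i w) (v0 : forall t, 0 <= v t).
Hypotheses (s0 : (0 < s)%N) (p01 : 0 <= p <= 1).
Hypothesis F_level : forall t, (t < s)%N -> F [set v t] = ((1 - p) / s%:R)%:E.
Hypothesis F_top : F [set v s] = p%:E.
Hypothesis F_low :
  F [set a | exists2 t, (t < s)%N & a = v t] = (1 - p)%:E.
Hypothesis F_support :
  F [set a | exists2 t, (t <= s)%N & a = v t] = 1%E.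
Hypothesis v_gap : forall t, (t < s)%N -> v t <= v s / B.
Hypothesis iidF : iid F (joint S X).
Hypothesis tauP : is_stopping_time r S X tau.

Local Notation Z := (coord S X).
Local Notation rho := (word_rule r v).

Let mZ l a : measurable [set w | Z w l = a].
Proof. exact: (@measurable_coord_preimage _ _ _ _ _ _ _ _ _ [set a]). Qed.

Let mtau i : measurable [set w | tau w = Some i].
Proof. by case: (tauP i). Qed.

Let mlevels m : measurable [set a : R | exists2 t, (t < m)%N & a = v t].
Proof.
have -> : [set a : R | exists2 t, (t < m)%N & a = v t] = \bigcup_(t in `I_m) [set v t].
  by [].
by apply: fin_bigcup_measurable => // t _; exact: measurable_set1.
Qed.

Lemma prefix_probability (m : nat) (c : nat -> R) : (m <= k + n)%N ->
  P [set w | forall l, (l < m)%N -> Z w l = c l] = (\prod_(l < m) F [set c l])%E.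
Proof.
move=> mkn.
have -> : [set w | forall l, (l < m)%N -> Z w l = c l] =
    [set w | forall l : 'I_(k + n), (l < m)%N -> [set c l] (Z w l)].
  apply/seteqP; split => w /= h; first by move=> l; exact: h.
  by move=> l lm; exact: (h (Ordinal (leq_trans lm mkn))).
rewrite (@coord_independent _ _ _ _ _ _ _ _ _ iidF (fun l => (l < m)%N)
  (fun l => [set c l])) => [|l]; last exact: measurable_set1.
by rewrite (big_ord_widen _ (fun l => F [set c l]) mkn).
Qed.

(** The event fixes all that the rule sees up to index [i], so [stop_at] is constant on it and comes
    out of the integral; the factor [(1 - p) ^ (k + i)] is bounded by 1. *)
Lemma word_top_le (i : 'I_n) (y : seq nat) :
  size y = (k + i)%N -> all (ltn^~ s) y ->
  (P (([set w | tau w = Some i] `&` [set w | Z w (k + i) = v s])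
      `&` word_event Z v y) <=
   (p * s%:R^-1 ^+ (k + i) * stop rho i (rcons y s))%:E)%E.
Proof.
move=> sy ys.
pose c l := v (nth 0%N (rcons y s) l).
pose A := [set ab : k.-tuple R * n.-tuple R | forall l, (l < (k + i).+1)%N ->
  nth 0 (ab.1 ++ ab.2) l = c l].
have mA : measurable A.
  have -> : A = \bigcap_(l in `I_(k + i).+1)
      ((fun ab : k.-tuple R * n.-tuple R => nth 0 (ab.1 ++ ab.2) l) @^-1` [set c l]).
    by [].
  apply: fin_bigcap_measurable => // l _.
  have := @measurable_nth_cat R k n l measurableT _ (measurable_set1 (c l)).
  by rewrite setTI.
have [_ /(_ A mA)] := tauP i.
set SXA := [set w | A _] => tauA.
have SXAE : SXA = [set w | forall l, (l < (k + i).+1)%N -> Z w l = c l] by [].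
have -> : ([set w | tau w = Some i] `&` [set w | Z w (k + i) = v s])
      `&` word_event Z v y = [set w | tau w = Some i] `&` SXA.
  rewrite SXAE; apply/seteqP; split => w /=.
    move=> [[tw zw] wy]; split => // l; rewrite /c nth_rcons sy ltnS leq_eqVlt.
    by case: ltngtP => //= lki _; [rewrite wy// sy|rewrite lki].
  move=> [tw wz]; split; first split => //.
    by rewrite wz// /c nth_rcons sy ltnn eqxx.
  by move=> l ly; rewrite wz -?sy ?leqW// /c nth_rcons ly.
rewrite tauA.
have mSXA : measurable SXA.
  have -> : SXA = \bigcap_(l in `I_(k + i).+1) [set w | Z w l = c l] by [].
  by apply: fin_bigcap_measurable.
rewrite (eq_integral (cst (stop rho i (rcons y s))%:E)); last first.
  move=> w; rewrite inE => wA /=; congr (_%:E); apply: stop_at_word => l lki.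
  exact: wA.
rewrite integral_cst//= muleC SXAE prefix_probability; last first.
  by rewrite -addnS leq_add2l.
have -> : (\prod_(l < (k + i).+1) F [set c l] =
    (((1 - p) / s%:R) ^+ (k + i) * p)%:E)%E.
  rewrite big_ord_recr/= {2}/c nth_rcons sy ltnn eqxx F_top EFinM; congr (_ * _)%E.
  rewrite (eq_bigr (fun=> ((1 - p) / s%:R)%:E)); last first.
    move=> l _; rewrite /c nth_rcons sy ltn_ord F_level//.
    by apply: (allP ys); rewrite mem_nth// sy.
  by rewrite prodEFin prodr_const card_ord.
rewrite -EFinM lee_fin; have /andP[h0 _] := stop01 (word_rule01 r v0) i (rcons y s).
apply: ler_wpM2r => //; rewrite mulrC; apply: ler_wpM2l; first by case/andP: p01.
rewrite expr_div_n exprVn; apply: ler_piMl; first by rewrite invr_ge0 exprn_ge0.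
by case/andP: p01 => p0 p1; rewrite exprn_ile1//; lra.
Qed.

(** Either all [k + i] earlier coordinates are below the top, which yields [hit], or one of them is
    not, which together with [X i] at the top has probability [p ^ 2]. *)
Lemma stop_top_le (i : 'I_n) :
  (P ([set w | tau w = Some i] `&` [set w | X i w = v s]) <=
   (p * hit k rho s i + (k + n)%:R * p ^+ 2)%:E)%E.
Proof.
have -> : [set w | X i w = v s] = [set w | Z w (k + i) = v s].
  by apply/seteqP; split => w /=; rewrite coord_rshift.
set E := _ `&` _; have mE : measurable E by exact: measurableI.
pose D := low_event Z v s (k + i).
have mD : measurable D by exact: measurable_low_event.
pose Low := [set a : R | exists2 t, (t < s)%N & a = v t].
(* Taking the complement of the lower levels, rather than [v s] itself, also covers the null set
   outside the support. *)
pose C l := [set w | ~ Low (Z w l)] `&` [set w | Z w (k + i) = v s].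
have mC l : measurable (C l).
  apply: measurableI => //.
  exact: (measurable_coord_preimage S X l (measurableC (mlevels s))).
have PC l : (l < k + i)%N -> P (C l) = (p * p)%:E.
  move=> lki.
  pose A m := if m == l then ~` Low else [set v s].
  have mAm m : measurable (A m).
    rewrite /A; case: ifP => _; last exact: measurable_set1.
    by apply: measurableC; exact: mlevels.
  have kin : (k + i < k + n)%N by rewrite ltn_add2l.
  have -> : C l = [set w | forall m : 'I_(k + n),
      ((m == l :> nat) || (m == k + i :> nat)%N) -> A m (Z w m)].
    apply/seteqP; split => w /=.
      move=> [Lw Zw] m /orP[|] /eqP ->; rewrite /A ?eqxx// gtn_eqF//.
    move=> h; split.
      have := h (Ordinal (ltn_trans lki kin)); rewrite /= eqxx => /(_ isT).
      by rewrite /A eqxx.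
    have := h (Ordinal kin); rewrite /= eqxx orbT => /(_ isT).
    by rewrite /A gtn_eqF.
  rewrite (coord_independent iidF (fun m => (m == l) || (m == k + i)%N) mAm).
  rewrite (bigD1 (Ordinal (ltn_trans lki kin))) ?eqxx//=.
  rewrite (big_pred1 (Ordinal kin)); last first.
    move=> m /=; rewrite -!val_eqE/=.
    by case: (eqVneq (nat_of_ord m) l) => [->|_]; rewrite ?andbF ?andbT// ltn_eqF.
  rewrite /A eqxx gtn_eqF// F_top probability_setC ?F_low; last exact: mlevels.
  by rewrite -EFinB subKr EFinM.
apply: (@le_trans _ _ (P (E `&` D) + P (\big[setU/set0]_(l < k + i) C l))%E).
  apply: (@le_trans _ _ (P ((E `&` D) `|` \big[setU/set0]_(l < k + i) C l))).
    rewrite le_measure ?inE//.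
    - by apply: measurableU; [exact: measurableI|exact: bigsetU_measurable].
    - move=> w Ew; have [Dw|/existsNP[l /not_implyP[lki Lw]]] := pselect (D w).
        by left.
      by right; rewrite -(bigcup_mkord _ C); exists l => //; split => //; case: Ew.
  by apply: measureU2; [exact: measurableI|exact: bigsetU_measurable].
rewrite EFinD; apply: leeD.
  apply: low_event_le_avg => // y; exact: word_top_le.
apply: le_trans (Boole_inequality P (fun l _ => mC l)) _.
rewrite (eq_bigr (fun=> (p * p)%:E)) => [|l _]; last exact: PC.
rewrite sumEFin sumr_const card_ord lee_fin -[p * p *+ _]mulr_natl -expr2.
by apply: ler_wpM2r; [rewrite sqr_ge0|rewrite ler_nat leq_add2l ltnW].
Qed.

Hypothesis B1 : 1 <= B.

Let B0 : 0 < B. Proof. exact: lt_le_trans B1. Qed.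

Let v_le t : (t <= s)%N -> v t <= v s.
Proof.
rewrite leq_eqVlt => /predU1P[->//|/v_gap] h; apply: le_trans h _.
by rewrite ler_pdivrMr// ler_peMr.
Qed.

Lemma ae_support :
  {ae P, forall w, forall i : 'I_n, exists2 t, (t <= s)%N & X i w = v t}.
Proof.
apply: filter_forall => i.
pose L := [set a : R | exists2 t, (t <= s)%N & a = v t].
have mL : measurable L by exact: (mlevels s.+1).
exists (X i @^-1` ~` L); split => //.
  rewrite -[X in measurable X]setTI; apply: measurable_funP => //.
  exact: measurableC.
have [_ /(_ (inr i) _ (measurableC mL))] := iidF.
by move=> PL; apply: etrans PL _; rewrite probability_setC// F_support subee.
Qed.

Lemma measurable_stopped_value : measurable_fun setT (stopped_value X tau).
Proof.
have -> : stopped_value X tau = fun w =>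
    \sum_(i < n) X i w * \1_[set w | tau w = Some i] w.
  apply/funext => w; rewrite /stopped_value; case tw: (tau w) => [i|].
    rewrite (bigD1 i)//= indicE mem_set ?mulr1// big1 ?addr0// => j /negP ji.
    rewrite indicE memNset ?mulr0//= => -[] jE; apply: ji.
    by move: jE; rewrite tw => -[->].
  by rewrite big1// => j _; rewrite indicE memNset ?mulr0//= tw.
by apply: measurable_sum => i; apply: measurable_funM.
Qed.

(** Almost surely, the stopped value is at most [v s / B] unless the stop is at the top level, where
    it equals [v s]. *)
Lemma expectation_stopped_value_le :
  ('E_P[stopped_value X tau] <= (v s * (B^-1 + \sum_(i < n)
     (p * hit k rho s i + (k + n)%:R * p ^+ 2)))%:E)%E.
Proof.
pose G i := [set w | tau w = Some i] `&` [set w | X i w = v s].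
have mG i : measurable (G i).
  apply: measurableI => //.
  have := @measurable_funPTI _ _ _ _ (X i) [set v s] (measurable_set1 _).
  by [].
pose h w := v s / B + \sum_(i < n) v s * \1_(G i) w.
have h0 w : 0 <= \sum_(i < n) v s * \1_(G i) w.
  by apply: sumr_ge0 => i _; rewrite mulr_ge0.
have vB0 : 0 <= v s / B by rewrite divr_ge0// ltW.
have mh' : measurable_fun setT (fun w => \sum_(i < n) v s * \1_(G i) w).
  by apply: measurable_sum => i; apply: measurable_funM.
apply: (@le_trans _ _ ('E_P[h])%E).
  apply: expectation_le.
  - exact: measurable_stopped_value.
  - exact: measurable_funD.
  - by move=> w; rewrite /stopped_value; case: (tau w).
  - by move=> w; rewrite addr_ge0.
  apply: filterS ae_support => w supp; rewrite /stopped_value.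
  case tw: (tau w) => [i|]; last by rewrite addr_ge0.
  have [t] := supp i; rewrite leq_eqVlt => /predU1P[-> wt|ts wt].
    rewrite /h (bigD1 i)//= indicE mem_set ?mulr1//.
    rewrite wt addrCA lerDl addr_ge0// sumr_ge0// => j _.
    by rewrite mulr_ge0.
  by rewrite wt; apply: le_trans (v_gap ts) _; rewrite lerDl.
rewrite unlock.
have -> : (\int[P]_w (h w)%:E =
    (v s / B)%:E + \sum_(i < n) (v s)%:E * P (G i))%E.
  under eq_integral do rewrite EFinD.
  rewrite ge0_integralD//=; last 2 first.
  - by move=> w _; rewrite lee_fin.
  - exact/measurable_EFinP.
  rewrite integral_cst//= probability_setT mule1; congr (_ + _)%E.
  under eq_integral do rewrite -sumEFin.
  rewrite ge0_integral_sum//=; last 2 first.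
  - move=> i; apply/measurable_EFinP; exact: measurable_funM.
  - by move=> i w _; rewrite lee_fin mulr_ge0.
  apply: eq_bigr => i _; under eq_integral do rewrite EFinM.
  rewrite ge0_integralZl_EFin//=; last exact/measurable_EFinP.
  by rewrite integral_indic// setIT.
rewrite mulrDr EFinD; apply: leeD => //.
rewrite mulr_sumr -sumEFin; apply: lee_sum => i _.
by rewrite [leRHS]EFinM; apply: lee_wpmul2l; [rewrite lee_fin|exact: stop_top_le].
Qed.

Lemma measurable_max_value : measurable_fun setT (max_value X).
Proof.
rewrite /max_value; elim: (index_enum _) => [|i e IH].
  rewrite (_ : (fun _ => _) = cst 0); first exact: measurable_cst.
  by apply/funext => w; rewrite big_nil.
rewrite (_ : (fun _ => _) =
    (X i : _ -> R) \max (fun w => \big[Num.max/0]_(j <- e) X j w)).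
  exact: measurable_maxr.
by apply/funext => w; rewrite big_cons.
Qed.

Lemma max_value_ge0 w : 0 <= max_value X w.
Proof. by rewrite /max_value; elim/big_ind: _ => // a b a0 b0; rewrite le_max a0. Qed.

(** A crude bound, giving finiteness of the expected maximum. *)
Lemma expectation_max_value_le : ('E_P[max_value X] <= (v s)%:E)%E.
Proof.
rewrite -(expectation_cst P (v s)); apply: expectation_le => //.
- exact: measurable_max_value.
- exact: max_value_ge0.
- by move=> w; exact: v0.
apply: filterS ae_support => w supp /=; rewrite /max_value.
elim/big_ind: _ => // [a b av bv|i _]; first by rewrite ge_max av.
by have [t ts ->] := supp i; exact: v_le.
Qed.

(** The maximum is at least [v s] as soon as one value has the top level, an event of probability
    [1 - (1 - p) ^ n]. *)
Lemma expectation_max_value_ge :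
  ((v s * (n%:R * p - n%:R ^+ 2 * p ^+ 2))%:E <= 'E_P[max_value X])%E.
Proof.
(* No value has the top level; [k <= l] leaves the samples unconstrained. *)
pose N := [set w | forall l : 'I_(k + n), (k <= l)%N -> (~` [set v s]) (Z w l)].
have mv : measurable (~` [set v s]) by apply: measurableC; exact: measurable_set1.
have PN : P N = ((1 - p) ^+ n)%:E.
  rewrite (coord_independent iidF (fun l => (k <= l)%N) (fun=> mv)).
  rewrite (eq_bigr (fun=> (1 - p)%:E)); last first.
    move=> l _; rewrite probability_setC ?F_top//; exact: measurable_set1.
  rewrite prodEFin big_split_ord/= big_pred0 => [|l]; last by rewrite leqNgt ltn_ord.
  rewrite (eq_bigl xpredT) => [|l]; last by rewrite /= leq_addr.
  by rewrite prodr_const card_ord mul1r.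
have mN : measurable N.
  have -> : N = \bigcap_(l in [set l : 'I_(k + n) | (k <= l)%N])
      [set w | (~` [set v s]) (Z w l)] by [].
  apply: fin_bigcap_measurable => [|l _]; first exact: finite_finset.
  exact: (measurable_coord_preimage S X l mv).
pose h w : R := v s * \1_(~` N) w.
apply: (@le_trans _ _ ('E_P[h])%E); last first.
  apply: expectation_le.
  - by apply: measurable_funM => //; apply: measurable_indic; exact: measurableC.
  - exact: measurable_max_value.
  - by move=> w; rewrite mulr_ge0.
  - exact: max_value_ge0.
  apply: aeW => w; rewrite /h indicE.
  have [/set_mem Nw|] := boolP (w \in ~` N); last by rewrite mulr0 max_value_ge0.
  rewrite mulr1; have /existsNP[l /not_implyP[kl /contrapT /= lv]] := Nw.
  have ln : (l - k < n)%N by rewrite ltn_subLR.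
  rewrite -lv -{1}(subnKC kl) (coord_rshift S X w (Ordinal ln)) /max_value.
  exact: le_bigmax.
rewrite unlock; under eq_integral do rewrite EFinM.
rewrite ge0_integralZl_EFin//=; last first.
  by apply/measurable_EFinP; apply: measurable_indic; exact: measurableC.
rewrite integral_indic//=; last exact: measurableC.
rewrite setIT probability_setC// PN -EFinB EFinM lee_wpmul2l ?lee_fin//.
by have := exprn_1subr_le n p01; lra.
Qed.

End Expectations.

(** * Choice of the parameters *)

Lemma harmonic_sum_unbounded (R : realType) (M : R) : exists L, M <= harmonic_sum R L.
Proof.
exists (Num.truncn (expR M)); set L := Num.truncn _.
have h : ln L.+1%:R <= harmonic_sum R L.
  have -> : ln L.+1%:R = \sum_(1 <= s < L.+1) (ln s.+1%:R - ln s%:R) :> R.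
    by rewrite (telescope_sumr (fun s => ln s%:R))// ln1 subr0.
  rewrite /harmonic_sum big_nat [leRHS]big_nat; apply: ler_sum => s /andP[s0 _].
  have S0 : 0 < s%:R :> R by rewrite ltr0n.
  rewrite -ln_div ?posrE ?ltr0n//.
  apply: le_trans (ln_le_subr1 _) _; first by rewrite divr_gt0// ltr0n.
  by rewrite -natr1 mulrDl divff ?lt0r_neq0// mul1r addrAC subrr add0r.
apply: le_trans h; rewrite -[leLHS]expRK ler_ln ?posrE ?expR_gt0 ?ltr0n//.
by apply/ltW/truncnS_gt.
Qed.

(** Otherwise the weighted sum of [f s - c] would be positive, strictly so because of the term
    [s = 1]. *)
Lemma weighted_pigeonhole (R : realFieldType) (L : nat) (f : nat -> R) (c : R) :
  (0 < L)%N -> \sum_(1 <= s < L.+1) s%:R^-1 * f s <= c * harmonic_sum R L ->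
  exists2 s, (0 < s)%N & f s <= c.
Proof.
move=> L0 fc; apply: contrapT => nfc.
have cf s : (0 < s)%N -> c < f s.
  by move=> s0; rewrite ltNge; apply/negP => fs; apply: nfc; exists s.
have : \sum_(1 <= s < L.+1) s%:R^-1 * (f s - c) <= 0.
  under eq_bigr do rewrite mulrBr.
  by rewrite sumrB -mulr_suml subr_le0 [leRHS]mulrC.
rewrite big_ltn// invr1 mul1r; apply/negP; rewrite -ltNge.
apply: ltr_pwDl; first by rewrite subr_gt0 cf.
rewrite big_nat; apply: sumr_ge0 => s /andP[s1 _].
by rewrite mulr_ge0 ?invr_ge0// subr_ge0 ltW// cf// ltnW.
Qed.

(** With [b = k + i + 1], the mixed hits are feasible for the linear program on [k + n] items; the
    error [2 i] is bounded uniformly by [2 n]. *)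
Lemma sum_mixed_hit_le (R : realType) (k n L : nat) (rho : nat -> seq nat -> R) :
  (0 < n)%N -> (forall i y, 0 <= rho i y <= 1) ->
  (forall i y t, (k + i < size y)%N -> rho i (rcons y t) = rho i y) ->
  \sum_(i < n) mixed_hit k rho L i <= (harmonic_sum R L + 2 * n%:R) *
    (1 + if k%:R / (k + n)%:R <= (expR 1)^-1 :> R then (k + n)%:R / expR 1
         else k%:R * ln ((k + n)%:R / k%:R)).
Proof.
move=> n0 rho01 rho_rcons.
pose x b := mixed_hit k rho L (b - k.+1).
have H0 : 0 <= harmonic_sum R L by apply: sumr_ge0 => s _; rewrite invr_ge0.
have xE (f : nat -> R) m : \sum_(k.+1 <= b < m) f b * x b =
    \sum_(i < m - k.+1) f (k + i).+1 * mixed_hit k rho L i.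
  rewrite -{1}[k.+1]add0n big_addn big_mkord; apply: eq_bigr => i _.
  by rewrite /x addnK addnC addSn.
have -> : \sum_(i < n) mixed_hit k rho L i = \sum_(k.+1 <= b < (k + n).+1) x b.
  have := xE (fun=> 1) (k + n).+1; rewrite subSS addKn.
  by under eq_bigr do rewrite mul1r; under [RHS]eq_bigr do rewrite mul1r.
apply: lp_bound.
- by rewrite addr_ge0// mulr_ge0.
- by rewrite -[ltnLHS]addn0 ltn_add2l.
- by move=> b; exact: mixed_hit_ge0.
move=> b /andP[kb bN].
rewrite (xE (fun c => c%:R^-1)).
apply: le_trans (mixed_hit_constraint rho01 rho_rcons L (b - k.+1)) _.
by rewrite lerD2l ler_pM2l// ler_nat leq_subLR addSn ltnW// ltnS.
Qed.

(** Identifies [n b(gamma)] at [gamma = k / n] with the value, up to rounding, of the linear program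
    on [k + n] items. *)
Lemma bound_natE (R : realType) (k n : nat) : (0 < n)%N ->
  n%:R * bound (k%:R / n%:R : R) =
  (if k%:R / (k + n)%:R <= (expR 1)^-1 :> R then (k + n)%:R / expR 1
   else k%:R * ln ((k + n)%:R / k%:R)).
Proof.
move=> n0; have N0 : 0 < n%:R :> R by rewrite ltr0n.
have K0 : 0 <= k%:R :> R by [].
have n1 : n%:R != 0 :> R by rewrite lt0r_neq0.
have nk : n%:R + k%:R != 0 :> R by rewrite lt0r_neq0// ltr_wpDr.
have kn : k%:R + n%:R != 0 :> R by rewrite addrC.
have ratioE : k%:R / n%:R / (1 + k%:R / n%:R) = k%:R / (k + n)%:R :> R.
  by rewrite natrD; field; rewrite ?n1 ?nk ?kn.
rewrite /bound ratioE; case: ifPn => [_|].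
  by rewrite natrD; field; rewrite ?n1 lt0r_neq0 ?expR_gt0.
move=> klt; have k0 : (0 < k)%N.
  by rewrite lt0n; apply: contraNneq klt => ->; rewrite mul0r invr_ge0 ltW// expR_gt0.
rewrite mulNr mulrN mulrA mulrCA divff ?lt0r_neq0// mulr1 -mulrN.
by rewrite -lnV ?invf_div// posrE divr_gt0// ltr0n// addn_gt0 k0.
Qed.

Lemma bound_ge0 (R : realType) (k n : nat) : (0 < n)%N ->
  0 <= bound (k%:R / n%:R : R).
Proof.
move=> n0; have N0 : 0 < n%:R :> R by rewrite ltr0n.
rewrite -(pmulr_rge0 _ N0) bound_natE//; case: ifP => _.
  by rewrite divr_ge0// ltW// expR_gt0.
have [->|k0] := posnP k; first by rewrite mul0r.
rewrite mulr_ge0// ln_ge0// ler_pdivlMr ?ltr0n// mul1r ler_nat.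
exact: leq_addr.
Qed.

Lemma exists_level_distribution (R : realType) (s : nat) (p : R) (v : nat -> R) :
  (0 < s)%N -> 0 <= p <= 1 -> injective v -> (forall t, 0 <= v t) ->
  exists F : probability R R, [/\ F [set x | 0 <= x] = 1%E,
    forall t, (t < s)%N -> F [set v t] = ((1 - p) / s%:R)%:E,
    F [set v s] = p%:E,
    F [set a | exists2 t, (t < s)%N & a = v t] = (1 - p)%:E &
    F [set a | exists2 t, (t <= s)%N & a = v t] = 1%E].
Proof.
move=> s0 /andP[p0 p1] vinj v0.
have S0 : s%:R != 0 :> R by rewrite pnatr_eq0 -lt0n.
have q0 : 0 <= (1 - p) / s%:R by rewrite divr_ge0// subr_ge0.
pose w t : {nonneg R} := if (t < s)%N then NngNum q0 else NngNum p0.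
have sumw (A : set R) : \sum_(t < s.+1) (w t)%:num * \1_A (v t) =
    \sum_(t < s) (1 - p) / s%:R * \1_A (v t) + p * \1_A (v s).
  rewrite big_ord_recr/= /w ltnn; congr (_ + _).
  by apply: eq_bigr => t _; rewrite ltn_ord.
have low1 : \sum_(t < s) (1 - p) / s%:R = 1 - p.
  by rewrite sumr_const card_ord -[_ / _ *+ s]mulr_natr divfK.
have all1 (A : set R) : (forall t, (t <= s)%N -> A (v t)) ->
    \sum_(t < s.+1) (w t)%:num * \1_A (v t) = 1.
  move=> hA; rewrite sumw (eq_bigr (fun=> (1 - p) / s%:R)) => [|t _].
    by rewrite low1 indicE mem_set ?mulr1 ?subrK//; exact: hA.
  by rewrite indicE mem_set ?mulr1//; apply: hA; exact: ltnW.
have w1 : \sum_(t < s.+1) (w t)%:num = 1.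
  by rewrite -(all1 setT)//; apply: eq_bigr => t _; rewrite indicT mulr1.
have [F FE] := exists_discrete_probability v w1.
exists F; split.
- by rewrite FE all1// => t _; exact: v0.
- move=> t ts; rewrite FE sumw (bigD1 (Ordinal ts))//= indicE mem_set// mulr1.
  rewrite big1 => [|j jt].
    rewrite indicE memNset ?mulr0 ?addr0//= => /vinj st.
    by rewrite st ltnn in ts.
  rewrite indicE memNset ?mulr0//= => /vinj jE.
  by move/eqP: jt; apply; apply: val_inj.
- rewrite FE sumw indicE mem_set// mulr1 big1 ?add0r// => j _.
  rewrite indicE memNset ?mulr0//= => /vinj jE.
  by have := ltn_ord j; rewrite jE ltnn.
- rewrite FE sumw (eq_bigr (fun=> (1 - p) / s%:R)) => [|t _].
    rewrite low1 indicE memNset ?mulr0 ?addr0//= => -[t ts] /vinj st.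
    by rewrite -st ltnn in ts.
  by rewrite indicE mem_set ?mulr1//; exists t.
- by rewrite FE all1// => t ts; exists t.
Qed.

(** [p] and [B] precede [rho]: the levels [B ^ t] must be fixed before a rule can be read on words.
    Only [s] depends on the rule. *)
Lemma exists_good_level (R : realType) (k n : nat) (delta : R) :
  (0 < n)%N -> 0 < delta -> 4 <= delta * n%:R ->
  let b : R := bound (k%:R / n%:R) in
  exists p B : R, [/\ 0 < p <= 1, 1 < B, n%:R * p < 1 &
    forall rho : nat -> seq nat -> R, (forall i y, 0 <= rho i y <= 1) ->
    (forall i y t, (k + i < size y)%N -> rho i (rcons y t) = rho i y) ->
    exists2 s, (0 < s)%N &
      B^-1 + \sum_(i < n) (p * hit k rho s i + (k + n)%:R * p ^+ 2) <=
      (b + delta) * (n%:R * p - n%:R ^+ 2 * p ^+ 2)].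
Proof.
move=> n0 d0 dn b; have b0 : 0 <= b by exact: bound_ge0.
have N1 : 1 <= n%:R :> R by rewrite ler1n.
have K0 : 0 <= k%:R :> R by [].
(* [D] collects the errors quadratic in [p], on both sides: together they are [n p * (p D)], and [p]
   makes this [n p delta / 4]. *)
pose D := (k + n)%:R + (b + delta) * n%:R.
have D0 : 0 < D by rewrite /D natrD; nra.
have dD : delta * n%:R <= D by rewrite /D natrD; nra.
pose p := delta / (4 * D).
have p0 : 0 < p by rewrite divr_gt0// mulr_gt0.
have pD : p * D = delta / 4 by rewrite /p; field; rewrite lt0r_neq0.
have np : n%:R * p <= 1 / 4.
  by rewrite /p mulrA ler_pdivrMr ?mulr_gt0//; lra.
have p1 : p <= 1 / 4 by nra.
(* The error [B^-1] is also allotted [n p delta / 4]; adding 1 ensures [1 < B]. *)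
pose B := 4 / (n%:R * p * delta) + 1.
have npd : 0 < n%:R * p * delta by do 2![apply: mulr_gt0 => //]; rewrite ltr0n.
have B1 : 1 < B by rewrite /B ltrDr divr_gt0.
have BV : B^-1 <= n%:R * p * delta / 4.
  rewrite -[leRHS]invf_div lef_pV2 ?posrE ?divr_gt0//; last lra.
  by rewrite /B lerDl.
exists p, B; split => //; [lra|lra|] => rho rho01 rho_rcons.
pose Lam := 1 + n%:R * b.
(* [L] is large enough for the bounded error [2 n] of the constraints to be negligible against the
   mass of the prior. *)
have [L HL] := harmonic_sum_unbounded (8 * Lam / delta).
have Lam1 : 1 <= Lam by rewrite /Lam lerDl mulr_ge0.
have HL0 : 0 < harmonic_sum R L.
  by apply: lt_le_trans HL; rewrite divr_gt0// mulr_gt0//; lra.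
have L0 : (0 < L)%N.
  rewrite lt0n; apply: contraTneq HL0 => ->.
  by rewrite /harmonic_sum big_geq// ltxx.
apply: (weighted_pigeonhole L0).
set H := harmonic_sum R L in HL HL0 *.
have mixed : \sum_(i < n) mixed_hit k rho L i <= (H + 2 * n%:R) * Lam.
  by rewrite /Lam bound_natE//; exact: sum_mixed_hit_le.
have -> : \sum_(1 <= s < L.+1) s%:R^-1 *
    (B^-1 + \sum_(i < n) (p * hit k rho s i + (k + n)%:R * p ^+ 2)) =
    H * (B^-1 + n%:R * ((k + n)%:R * p ^+ 2)) + p * \sum_(i < n) mixed_hit k rho L i.
  rewrite /H /harmonic_sum mulr_suml mulr_sumr /mixed_hit.
  under [X in _ = _ + X]eq_bigr do rewrite mulr_sumr.
  rewrite [X in _ = _ + X]exchange_big/= -big_split/=; apply: eq_bigr => s _.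
  rewrite big_split/= sumr_const card_ord -[_ * p ^+ 2 *+ n]mulr_natl !mulrDr -!addrA.
  congr (_ + _); rewrite addrC; congr (_ + _).
  by rewrite mulr_sumr; apply: eq_bigr => i _; rewrite mulrCA.
have h1 : 8 * Lam <= H * delta by rewrite -ler_pdivrMr.
(* The remaining [delta / 2] is shared equally: [4 <= delta n] absorbs the 1 in [Lam], and the
   choice of [L] absorbs [2 n * Lam]. *)
have h2 : (H + 2 * n%:R) * Lam <= H * (n%:R * (b + delta / 2)).
  have : n%:R * (8 * Lam) <= n%:R * (H * delta) by rewrite ler_wpM2l.
  have : H * 4 <= H * (delta * n%:R) by rewrite ler_pM2l.
  rewrite /Lam; lra.
have h3 : p * \sum_(i < n) mixed_hit k rho L i <= p * (H * (n%:R * (b + delta / 2))).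
  by rewrite ler_pM2l//; apply: le_trans h2.
apply: le_trans (lerD (lexx _) h3) _.
rewrite [leRHS]mulrC [p * _]mulrCA -mulrDr ler_pM2l//.
have : n%:R * p * (p * D) = n%:R * p * (delta / 4) by rewrite pD.
rewrite /D; lra.
Qed.

Unset Implicit Arguments.

Theorem theorem11 (R : realType) (delta : R) (gamma : rat)
    (delta_gt0 : 0 < delta) (gamma_ge0 : 0 <= gamma) :
  exists2 n0 : nat, (0 < n0)%N &
  forall n k : nat, (n0 <= n)%N -> gamma * n%:R = k%:R ->
  forall r : stopping_rule R k n,
  exists2 F : probability R R, F [set x : R | 0 <= x] = 1%E &
  forall (d : measure_display) (Omega : measurableType d)
    (P : probability Omega R)
    (S : 'I_k -> {RV P >-> R}) (X : 'I_n -> {RV P >-> R})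
    (tau : Omega -> option 'I_n),
    (forall (j : 'I_k) (w : Omega), 0 <= S j w) ->
    (forall (i : 'I_n) (w : Omega), 0 <= X i w) ->
    iid F (joint S X) ->
    is_stopping_time r S X tau ->
    [/\ (0 < 'E_P[max_value X])%E,
        ('E_P[max_value X] < +oo)%E &
        ('E_P[stopped_value X tau] <=
           (bound (ratr gamma) + delta)%:E * 'E_P[max_value X])%E].
Proof.
(* This ensures [4 <= delta n], which pays for the rounding in the linear program. *)
exists (Num.truncn (4 / delta)).+1 => // n k n0n gnk r.
have n0 : (0 < n)%N by apply: leq_trans n0n.
have N0 : 0 < n%:R :> R by rewrite ltr0n.
have -> : ratr gamma = k%:R / n%:R :> R.
  have /(congr1 (@ratr R)) := gnk; rewrite rmorphM/= !ratr_nat => <-.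
  by rewrite mulfK// lt0r_neq0.
have dn : 4 <= delta * n%:R.
  rewrite mulrC -ler_pdivrMr// (le_trans (ltW (truncnS_gt _)))// ler_nat.
  exact: n0n.
have [p [B [/andP[p0 p1] B1 np1 good]]] := exists_good_level k n0 delta_gt0 dn.
have B0 : 0 < B by exact: lt_trans B1.
pose v t := B ^+ t.
have v0 t : 0 <= v t by rewrite exprn_ge0// ltW.
have vinj : injective v by apply: ieexprIn => //; rewrite gt_eqF.
(* The top level is chosen against the given rule, read on the levels [B ^ t]. *)
have [s s0 s_good] := good (word_rule r v) (word_rule01 r v0)
  (fun i y t => @word_rule_rcons _ _ _ r v i y t).
have p01 : 0 <= p <= 1 by rewrite ltW.
have [F [F_ge0 F_level F_top F_low F_support]] :=
  exists_level_distribution s0 p01 vinj v0.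
exists F => // d Omega P S X tau _ X0 iidF tauP.
have v_gap t : (t < s)%N -> v t <= v s / B.
  move=> ts; rewrite /v -(prednK s0) exprSr mulfK ?gt_eqF//.
  by rewrite ler_eXn2l// -ltnS prednK.
have hle : ('E_P[max_value X] <= (v s)%:E)%E.
  exact: (expectation_max_value_le X0 v0 F_support v_gap iidF (ltW B1)).
have hge : ((v s * (n%:R * p - n%:R ^+ 2 * p ^+ 2))%:E <= 'E_P[max_value X])%E.
  exact: (expectation_max_value_ge X0 v0 p01 F_top iidF).
have hst := expectation_stopped_value_le X0 v0 p01 F_level F_top F_low
  F_support v_gap iidF tauP (ltW B1).
have vs0 : 0 < v s by rewrite exprn_gt0.
have m0 : 0 < n%:R * p - n%:R ^+ 2 * p ^+ 2.
  by rewrite -exprMn expr2 -[X in X - _]mulr1 -mulrBr mulr_gt0 ?mulr_gt0// subr_gt0.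
split.
- by apply: lt_le_trans hge; rewrite lte_fin mulr_gt0.
- by apply: le_lt_trans hle _; rewrite ltry.
apply: le_trans hst _.
(* The factor [v s] cancels, leaving the inequality for which [s] was chosen; the lower bound on the
   expected maximum then concludes. *)
apply: (@le_trans _ _ ((bound (k%:R / n%:R) + delta)%:E *
    (v s * (n%:R * p - n%:R ^+ 2 * p ^+ 2))%:E)%E).
  by rewrite -EFinM lee_fin [leRHS]mulrCA ler_pM2l.
by rewrite lee_wpmul2l// lee_fin addr_ge0 ?bound_ge0// ltW.
Qed.
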